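(* Let $\ell:[0,\infty)^d\to\mathbb{R}$ have a unique maximizer $\hat\theta$ over $\Theta=[0,\infty)^d$, let $\pi=\bigotimes_{j\in[d]}\pi_j$ with each $\pi_j$ log-concave, and let $S_0,S_1,d_0,d_1$ and the good set $\hat\Theta_\delta$ be as defined in the context. Assume that: (1) for some $C_0>0$, $\inf_{i\in S_0}|\hat\theta_i|\ge C_0$ (and $0<\delta_0\sqrt{d_0/n}<C_0$); (2) there is $C_{S_0}>0$ with $-\nabla^2_{S_0}\ell(\theta)\succeq C_{S_0}I$ for all $\theta\in\hat\Theta_\delta$; (3) there is $C_{S_1}>0$ with $\partial_j\ell(\hat\theta)\le -C_{S_1}$ for all $j\in S_1$; (4) $\ell$ is $C^2$ on $\hat\Theta_\delta$ and $\sup_{\theta\in\hat\Theta_\delta}\|\nabla^2\ell(\theta)\|_{\rm op}\le s_2<\infty$. Then there are functions $f$, $g_j$ ($j\in S_1$), $B$ such that $$\ell(\theta)=B(\theta)+f(\theta_{S_0})+\sum_{j\in S_1}g_j(\theta_j),\qquad \theta\in\hat\Theta_\delta,$$ with the following properties: (a) $f$ is $C_{S_0}$-strongly concave; (b) each $g_j$ is linear with slope $\partial_j\ell(\hat\theta)\le -C_{S_1}$; (c) $\operatorname{osc}B=\sup B-\inf B\le 2s_2\Bigl(\dfrac{\delta_0\delta_1(d_0d_1)^{1/2}}{n^{3/2}}+\dfrac{\delta_1^2d_1}{n^2}\Bigr)$, where the supremum and infimum are over $\hat\Theta_\delta$.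
   Context: Notation: $[d]=\{1,\dots,d\}$. For $S\subseteq[d]$, $\theta_S$ is the subvector of $\theta$ indexed by $S$, and $\nabla^2_{S}\ell$ is the $S\times S$ block of the Hessian. Derivatives at points of the boundary of $[0,\infty)^d$ are one-sided. $\ell$ is $C^2$ in the interior of $[0,\infty)^d$; $n>0$ is a parameter. The underlying Gibbs measure is $\mu(\theta)\propto\pi(\theta)e^{n\ell(\theta)}$ on $\Theta=[0,\infty)^d$. Index sets: $S_0=\{j\in[d]:\hat\theta_j>0\}$, $S_1=\{j\in[d]:\hat\theta_j=0\}$, $d_0=|S_0|$, $d_1=|S_1|$; it is assumed that $d_1\ge1$. Good set: for $\delta_0,\delta_1>0$, $$\hat\Theta_\delta=\Bigl\{\theta\in\Theta:\ \|\theta_{S_0}-\hat\theta_{S_0}\|_2\le\delta_0\sqrt{d_0/n},\ \|\theta_{S_1}-\hat\theta_{S_1}\|_\infty\le\delta_1/n\Bigr\}.$$ $f$ is viewed as a function on $\{\theta_{S_0}\in\mathbb{R}^{d_0}:\|\theta_{S_0}-\hat\theta_{S_0}\|_2\le\delta_0\sqrt{d_0/n}\}$ and $g_j$ as a function on $[0,\delta_1/n]$. *)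

(* Defs.v *)
From HB Require Import structures.
From mathcomp Require Import all_boot all_order all_algebra.
From mathcomp Require Import all_classical all_reals all_analysis.

Set Implicit Arguments.
Unset Strict Implicit.
Unset Printing Implicit Defensive.

Import Order.TTheory GRing.Theory Num.Theory.
Import numFieldNormedType.Exports.

Local Open Scope classical_set_scope.
Local Open Scope ring_scope.

(* Vectors of R^d are row vectors. The norm [`|x|] that the library puts on
   ['rV[R]_d] is the sup norm; the Euclidean norm is [l2norm]. *)
Definition l2norm (R : realType) (d : nat) (x : 'rV[R]_d) : R :=
  Num.sqrt (\sum_(i < d) x 0 i ^+ 2).

(* [v *m M^T] is the row form of the matrix-vector product M v. *)
Definition opnorm (R : realType) (d : nat) (M : 'M[R]_d) : R :=
  sup [set l2norm (v *m M^T) | v in [set v : 'rV[R]_d | l2norm v <= 1]].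

Definition loewner_ge (R : realType) (d : nat) (M N : 'M[R]_d) : Prop :=
  forall v : 'rV[R]_d, 0 <= (v *m (M - N) *m v^T) 0 0.

(* Coordinates indexed by S, listed in the order of [enum S]. *)
Definition subvec (R : realType) (d : nat) (S : {set 'I_d}) (x : 'rV[R]_d) :
    'rV[R]_#|S| :=
  \row_(k < #|S|) x 0 (enum_val k).

Definition submat (R : realType) (d : nat) (S : {set 'I_d}) (M : 'M[R]_d) :
    'M[R]_#|S| :=
  \matrix_(k < #|S|, l < #|S|) M (enum_val k) (enum_val l).

Definition orthant (R : realType) (d : nat) : set 'rV[R]_d :=
  [set x | forall i, 0 <= x 0 i].
Arguments orthant : clear implicits.

Definition unique_maximizer (R : realType) (d : nat) (A : set 'rV[R]_d)
    (ell : 'rV[R]_d -> R) (x : 'rV[R]_d) : Prop :=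
  [/\ A x, (forall y, A y -> ell y <= ell x) &
      forall z, A z -> (forall y, A y -> ell y <= ell z) -> z = x].

Definition log_concave_nneg (R : realType) (p : R -> R) : Prop :=
  (forall x, 0 <= x -> 0 <= p x) /\
  (forall x y t, 0 <= x -> 0 <= y -> 0 < t < 1 ->
    p x `^ t * p y `^ (1 - t) <= p (t * x + (1 - t) * y)).

(* Derivatives of functions on the orthant. A function on the orthant is a
   total function whose values elsewhere are irrelevant: at a point x of the
   orthant, the i-th partial derivative is the two-sided one if [0 < x 0 i], in
   which case x + h e_i stays in the orthant for small h, and the right one if
   [x 0 i = 0]. *)
Definition has_partial (R : realType) (d : nat) (ell : 'rV[R]_d -> R)
    (i : 'I_d) (x : 'rV[R]_d) : Prop :=
  if 0 < x 0 i then derivable ell x (delta_mx 0 i)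
  else cvg (h^-1 *: (ell (h *: delta_mx 0 i + x) - ell x) @[h --> 0^'+]).

Definition partial (R : realType) (d : nat) (ell : 'rV[R]_d -> R)
    (i : 'I_d) (x : 'rV[R]_d) : R :=
  if 0 < x 0 i then 'D_(delta_mx 0 i) ell x
  else lim (h^-1 *: (ell (h *: delta_mx 0 i + x) - ell x) @[h --> 0^'+]).

Definition hessian (R : realType) (d : nat) (ell : 'rV[R]_d -> R)
    (x : 'rV[R]_d) : 'M[R]_d :=
  \matrix_(i < d, j < d) partial (partial ell j) i x.

(* C^2 on a subset A of the orthant. The second partial derivatives at x are
   limits involving the first ones at nearby points of the orthant, which may
   lie outside A; hence the first partial derivatives are required to exist on a
   neighbourhood of x relative to the orthant. *)
Definition C2_on (R : realType) (d : nat) (A : set 'rV[R]_d)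
    (ell : 'rV[R]_d -> R) : Prop :=
  [/\ forall x i, A x ->
        \forall y \near within (orthant R d) (nbhs x), has_partial ell i y,
      forall x i j, A x -> has_partial (partial ell j) i x,
      {within A, continuous ell},
      forall i, {within A, continuous (partial ell i)} &
      forall i j, {within A, continuous (fun x => hessian ell x i j)}].

Definition S0 (R : realType) (d : nat) (that : 'rV[R]_d) : {set 'I_d} :=
  [set j | 0 < that 0 j]%SET.

Definition S1 (R : realType) (d : nat) (that : 'rV[R]_d) : {set 'I_d} :=
  [set j | that 0 j == 0]%SET.

Definition l2ball (R : realType) (d : nat) (c : 'rV[R]_d) (r : R) :
    set 'rV[R]_d :=
  [set x | l2norm (x - c) <= r].

Definition good_set (R : realType) (d : nat) (that : 'rV[R]_d)
    (n delta0 delta1 : R) : set 'rV[R]_d :=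
  [set x | [/\ orthant R d x,
    l2ball (subvec (S0 that) that) (delta0 * Num.sqrt (#|S0 that|%:R / n))
           (subvec (S0 that) x) &
    `|subvec (S1 that) x - subvec (S1 that) that| <= delta1 / n]].

Definition strongly_concave_on (R : realType) (d : nat) (A : set 'rV[R]_d)
    (C : R) (f : 'rV[R]_d -> R) : Prop :=
  forall x y t, A x -> A y -> 0 <= t <= 1 ->
    t * f x + (1 - t) * f y + C / 2 * t * (1 - t) * l2norm (x - y) ^+ 2
      <= f (t *: x + (1 - t) *: y).

Definition osc_on (R : realType) (d : nat) (A : set 'rV[R]_d)
    (B : 'rV[R]_d -> R) : \bar R :=
  (ereal_sup [set (B x)%:E | x in A] - ereal_inf [set (B x)%:E | x in A])%E.

(* Main.v *)
(* Take f(u) = ell(u, 0) and g_j(t) = d_j ell(that) t; B is the remainder.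
   Integrating along the segment from (theta_S0, 0) to theta, the remainder is
   bounded by |theta_S1| times the variation of the gradient from that, hence
   by s2 |theta_S1| (|theta_S0 - that_S0| + |theta_S1|). Only the continuity of
   ell and of its first partial derivatives is used on the boundary of the
   orthant: all the estimates are first proved at points with positive
   coordinates, where ell is C^2 in the usual sense, and then extended by
   continuity. *)

Require Import Defs.
From HB Require Import structures.
From mathcomp Require Import all_boot all_order all_algebra.
From mathcomp Require Import all_classical all_reals all_analysis.
From mathcomp Require Import ring lra.

Import Order.TTheory GRing.Theory Num.Theory.
Import numFieldNormedType.Exports.

Local Open Scope classical_set_scope.
Local Open Scope ring_scope.

(** * Directional derivatives, the mean value theorem on segments, and continuous partial
    derivatives *)

(** Both difference quotients are the same function of [h]; this opens directional derivatives to
    one-variable calculus. *)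
Lemma is_derive_line (R : realType) (V : normedModType R) (F : V -> R)
    (x v : V) (t D : R) :
  is_derive (t *: v + x) v F D <->
  is_derive t 1 (fun s : R => F (s *: v + x)) D.
Proof.
have E : (fun h : R => h^-1 *: ((F \o shift (t *: v + x)) (h *: v) -
                                F (t *: v + x))) =
  (fun h : R => h^-1 *: (((fun s : R => F (s *: v + x)) \o shift t) (h *: 1) -
                         F (t *: v + x))).
  apply/funext => h /=; congr (_ *: (F _ - _)).
  by rewrite /= [h *: 1]mulr1 scalerDl addrA.
by split=> -[d e]; split; move: d e; rewrite /derivable /derive E.
Qed.

Lemma is_derive_scale_dir (R : realType) (V : normedModType R) (F : V -> R)
    (x v : V) (w D : R) :
  is_derive x v F D -> is_derive x (w *: v) F (w * D).
Proof.
have E0 u : x = 0 *: u + x by rewrite scale0r add0r.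
rewrite {1}(E0 v) => /is_derive_line FD.
rewrite (E0 (w *: v)); apply/is_derive_line.
have -> : (fun s : R => F (s *: (w *: v) + x)) =
    (fun s : R => F (s *: v + x)) \o (w \*: id).
  by apply/funext => s /=; rewrite scalerA mulrC.
rewrite mulrC; apply: is_derive1_comp.
  by rewrite /= scaler0.
by apply: is_derive_eq; rewrite [LHS]mulr1.
Qed.

Lemma MVT_line (R : realType) (V : normedModType R) (F dF : V -> R) (x v : V) :
  (forall t : R, 0 <= t <= 1 ->
     is_derive (t *: v + x) v F (dF (t *: v + x))) ->
  exists2 t : R, 0 <= t <= 1 & F (v + x) - F x = dF (t *: v + x).
Proof.
move=> Fdrv.
have drv (t : R) : 0 <= t <= 1 ->
    is_derive t 1 (fun s : R => F (s *: v + x)) (dF (t *: v + x)).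
  by move=> /Fdrv /is_derive_line.
have [t||c + E] := @MVT_segment R (fun s : R => F (s *: v + x))
    (fun s => dF (s *: v + x)) 0 1 ler01.
- by rewrite in_itv /= => /andP[t0 t1]; apply: drv; rewrite !ltW.
- apply: derivable_within_continuous => t; rewrite in_itv /= => t01.
  exact: (@ex_derive _ _ _ _ _ _ _ (drv _ t01)).
- rewrite in_itv /= => c01; exists c => //.
  by move: E; rewrite scale1r scale0r add0r subr0 mulr1.
Qed.

Lemma ler_norm_coord (R : realType) (d : nat) (v : 'rV[R]_d) (i : 'I_d) :
  `|v 0 i| <= `|v|.
Proof.
rewrite [leRHS]/Num.Def.normr /= mx_normrE.
exact: (le_bigmax _ (fun ij : 'I_1 * 'I_d => `|v ij.1 ij.2|) (0, i)).
Qed.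

(* Passes from [x] to [y] by changing one coordinate at a time. *)
Lemma taylor1_partials (R : realType) (d : nat) (F : 'rV[R]_d -> R)
    (P : 'I_d -> 'rV[R]_d -> R) (a : 'I_d -> R) (x y : 'rV[R]_d) (e : R) :
  (forall z : 'rV[R]_d, (forall i, `|z 0 i - x 0 i| <= `|y 0 i - x 0 i|) ->
   forall i,
     is_derive z (delta_mx 0 i) F (P i z) /\ `|P i z - a i| <= e) ->
  `|F y - F x - \sum_i (y 0 i - x 0 i) * a i| <= d%:R * (`|y - x| * e).
Proof.
move=> FP.
pose z (k : nat) : 'rV[R]_d := \row_i (if (i < k)%N then y 0 i else x 0 i).
have z0 : z 0%N = x by apply/rowP => i; rewrite mxE ltn0.
have zd : z d = y by apply/rowP => i; rewrite mxE ltn_ord.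
have -> : F y - F x = \sum_(i < d) (F (z i.+1) - F (z i)).
  rewrite -(big_mkord xpredT (fun i => F (z i.+1) - F (z i))).
  by rewrite telescope_sumr// zd z0.
rewrite -sumrB (le_trans (ler_norm_sum _ _ _))//.
rewrite mulr_natl -[X in _ <= _ *+ X]card_ord -sumr_const.
apply: ler_sum => k _.
set w := y 0 k - x 0 k.
have zS : z k.+1 = w *: delta_mx 0 k + z k.
  apply/rowP => i; rewrite !mxE ltnS leq_eqVlt /= -val_eqE /=.
  case: (eqVneq (i : nat) k) => [/val_inj ->|ik] /=.
    by rewrite ltnn mulr1 subrK.
  by rewrite mulr0 add0r.
(* Every coordinate segment stays in the box around [x] spanned by [y], so [FP] applies at each
   intermediate point. *)
have seg (t : R) : 0 <= t <= 1 -> forall i,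
    `|(t *: (w *: delta_mx 0 k) + z k) 0 i - x 0 i| <= `|y 0 i - x 0 i|.
  move=> /andP[t0 t1] i; rewrite !mxE /= -val_eqE /=.
  case: (eqVneq (i : nat) k) => [/val_inj ->|ik] /=.
    by rewrite ltnn mulr1 addrK normrM ger0_norm// ler_piMl.
  by rewrite !mulr0 add0r; case: ifP => // _; rewrite subrr normr0.
have [t t01 Et] := @MVT_line _ _ F (fun u => w * P k u) (z k) (w *: delta_mx 0 k)
  (fun t t01 => is_derive_scale_dir _ _ _ _ _ _ _ (proj1 (FP _ (seg t t01) k))).
rewrite zS Et -mulrBr normrM ler_pM//.
  by have := ler_norm_coord _ _ (y - x) k; rewrite !mxE.
exact: (proj2 (FP _ (seg t t01) k)).
Qed.

(** By [taylor1_partials], the increment along [h *: v] differs from its linear part by at most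
    [d |h v|] times the oscillation of the [P i] near [x]; dividing by [|h|] leaves an arbitrarily
    small error. *)
Lemma is_derive_partials (R : realType) (d : nat) (F : 'rV[R]_d -> R)
    (P : 'I_d -> 'rV[R]_d -> R) (x v : 'rV[R]_d) :
  (\forall y \near x, forall i, is_derive y (delta_mx 0 i) F (P i y)) ->
  (forall i, {for x, continuous (P i)}) ->
  is_derive x v F (\sum_i v 0 i * P i x).
Proof.
move=> FP Pc.
suff lim_ : (fun h : R => h^-1 *: ((F \o shift x) (h *: v) - F x)) @ 0^' -->
    \sum_i v 0 i * P i x.
  split; last exact/cvg_lim.
  by apply/cvg_ex; exists (\sum_i v 0 i * P i x).
apply/cvgrPdist_le => /= e e0.
(* Chosen so that [d |v| (e / M) <= e]; the [+ 1] keeps [M] positive when [v] or [d] is zero. *)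
set M : R := d%:R * `|v| + 1.
have M0 : 0 < M by rewrite ltr_wpDl// mulr_ge0.
have eM : 0 < e / M by rewrite divr_gt0.
have nearP : \forall y \near x, forall i,
    is_derive y (delta_mx 0 i) F (P i y) /\ `|P i y - P i x| <= e / M.
  have Pn : \forall y \near x, forall i, `|P i y - P i x| <= e / M.
    apply: (@filter_forall _ _ (fun i y => `|P i y - P i x| <= e / M)
      (nbhs x)) => i.
    have /cvgrPdist_le/(_ _ eM) := Pc i.
    by apply: filterS => y; rewrite distrC.
  by near=> y => i; split; move: i; near: y.
have [r /= r0 rP] := (@nbhs_ballP _ _ _ _).1 nearP.
near=> h.
have h0 : h != 0 by near: h; exact: nbhs_dnbhs_neq.
(* This keeps the whole box between [x] and [h *: v + x] inside the ball where [rP] holds. *)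
have hr : `|h| * (`|v| + 1) < r.
  rewrite -ltr_pdivlMr ?ltr_wpDl//.
  by near: h; apply: dnbhs0_lt; rewrite divr_gt0// ltr_wpDl.
have hv i : (h *: v + x) 0 i - x 0 i = h * v 0 i by rewrite !mxE addrK.
have := @taylor1_partials _ _ F P (fun i => P i x) x (h *: v + x) (e / M).
have -> : \sum_i ((h *: v + x) 0 i - x 0 i) * P i x =
    h * \sum_i v 0 i * P i x.
  by rewrite mulr_sumr; apply: eq_bigr => i _; rewrite hv mulrA.
rewrite addrK normrZ => T.
rewrite distrC -[X in `|_ - X|](mulKf h0) -[_ *: _]/(_ * _) -mulrBr normrM.
rewrite normfV ler_pdivrMl ?normr_gt0//.
apply: le_trans (T _) _.
  move=> z zx; apply: rP; split=> // i j; rewrite ord1 /ball /= distrC.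
  rewrite (le_lt_trans (zx j))// hv normrM (le_lt_trans _ hr)//.
  by rewrite ler_wpM2l// (le_trans (ler_norm_coord _ _ v j))// lerDl.
rewrite -(mulrA `|h|) mulrCA ler_wpM2l// mulrA.
rewrite mulrCA ler_piMr ?ltW//.
by rewrite ltr_pdivrMr// mul1r /M ltrDl.
Unshelve. all: by end_near. Qed.

(** * Concavity of one-variable functions from the sign of the second derivative *)

Lemma MVT_sub01 (R : realType) (f df : R -> R) (a b : R) :
  (forall s : R, 0 <= s <= 1 -> is_derive s 1 f (df s)) ->
  0 <= a -> a <= b -> b <= 1 ->
  exists2 s, a <= s <= b & f b - f a = df s * (b - a).
Proof.
move=> fdf a0 ab b1.
have sub s : a <= s <= b -> 0 <= s <= 1.
  by move=> /andP[xs sb]; rewrite (le_trans a0 xs) (le_trans sb b1).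
have [s||s + e] := @MVT_segment R f df a b ab.
- by rewrite in_itv /= => /andP[? ?]; apply/fdf/sub; rewrite !ltW.
- apply: derivable_within_continuous => s; rewrite in_itv /= => /sub s01.
  exact: (@ex_derive _ _ _ _ _ _ _ (fdf _ s01)).
- by rewrite in_itv /= => ?; exists s.
Qed.

(** The mean value theorem on [[0, t]] and [[t, 1]] gives slopes [D a] and [D b] with [a <= b].
    Since [D] decreases, the concavity gap [t (1 - t) (D a - D b)] is nonnegative. *)
Lemma concave_segment (R : realType) (phi D E : R -> R) (t : R) :
  (forall s : R, 0 <= s <= 1 -> is_derive s 1 phi (D s)) ->
  (forall s : R, 0 <= s <= 1 -> is_derive s 1 D (E s)) ->
  (forall s : R, 0 <= s <= 1 -> E s <= 0) ->
  0 <= t <= 1 -> t * phi 1 + (1 - t) * phi 0 <= phi t.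
Proof.
move=> phiD DE E_le0 /andP[t0 t1].
have [a /andP[a0 at_] Ea] := MVT_sub01 _ _ _ 0 t phiD (lexx 0) t0 t1.
have [b /andP[tb b1] Eb] := MVT_sub01 _ _ _ t 1 phiD t0 t1 (lexx 1).
have ab := le_trans at_ tb.
have [s /andP[as_ sb] Es] := MVT_sub01 _ _ _ a b DE a0 ab b1.
have Es0 : E s <= 0 by apply: E_le0; rewrite (le_trans a0 as_) (le_trans sb b1).
have ba : D b <= D a by rewrite -subr_le0 Es mulr_le0_ge0 ?subr_ge0.
rewrite -subr_ge0.
have -> : phi t - (t * phi 1 + (1 - t) * phi 0) = t * (1 - t) * (D a - D b).
  transitivity ((1 - t) * (phi t - phi 0) - t * (phi 1 - phi t)); first by ring.
  by rewrite Ea Eb; ring.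
by rewrite !mulr_ge0// subr_ge0.
Qed.

(** Adding the parabola [c / 2 * s ^+ 2] to [phi] leaves a concave function; the parabola's own gap
    is [c / 2 * t * (1 - t)]. *)
Lemma strongly_concave_segment (R : realType) (phi D E : R -> R) (c t : R) :
  (forall s : R, 0 <= s <= 1 -> is_derive s 1 phi (D s)) ->
  (forall s : R, 0 <= s <= 1 -> is_derive s 1 D (E s)) ->
  (forall s : R, 0 <= s <= 1 -> E s <= - c) ->
  0 <= t <= 1 ->
  t * phi 1 + (1 - t) * phi 0 + c / 2 * t * (1 - t) <= phi t.
Proof.
move=> phiD DE E_le t01.
pose q : R -> R := (c / 2) \*: (id ^+ 2).
have qD (s : R) : is_derive s 1 q (c * s).
  by apply: is_derive_eq; rewrite /= /GRing.scale /=; field.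
have idD (s : R) : is_derive s 1 (c \*: id : R -> R) c.
  by apply: is_derive_eq; rewrite [LHS]mulr1.
have := @concave_segment R (phi + q) (D + c \*: id) (fun s => E s + c) t.
have qE x : (phi + q) x = phi x + c / 2 * x ^+ 2 by [].
rewrite !qE.
have H1 (s : R) : 0 <= s <= 1 -> is_derive s 1 (phi + q) ((D + c \*: id) s).
  by move=> /phiD ?; apply: is_deriveD.
have H2 (s : R) : 0 <= s <= 1 -> is_derive s 1 (D + c \*: id) (E s + c).
  by move=> /DE ?; apply: is_deriveD.
have H3 (s : R) : 0 <= s <= 1 -> E s + c <= 0.
  by move=> /E_le; rewrite -lerBrDr sub0r.
by move=> /(_ H1 H2 H3 t01); lra.
Qed.

(** * Euclidean norm and operator norm *)

Section Euclidean.
Context {R : realType} {d : nat}.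
Implicit Types (u v x y : 'rV[R]_d) (M : 'M[R]_d).

Lemma l2norm_ge0 v : 0 <= l2norm v.
Proof. exact: sqrtr_ge0. Qed.

Lemma sqr_l2norm v : l2norm v ^+ 2 = \sum_i v 0 i ^+ 2.
Proof. by rewrite sqr_sqrtr// sumr_ge0// => i _; rewrite sqr_ge0. Qed.

Lemma l2norm_le v (c : R) :
  0 <= c -> \sum_i v 0 i ^+ 2 <= c ^+ 2 -> l2norm v <= c.
Proof. by move=> c0 h; rewrite -ler_sqr ?nnegrE ?l2norm_ge0// sqr_l2norm. Qed.

Lemma l2norm_coord v i : `|v 0 i| <= l2norm v.
Proof.
rewrite -ler_sqr ?nnegrE ?l2norm_ge0// sqr_l2norm real_normK ?num_real//.
by rewrite (bigD1 i)//= lerDl sumr_ge0// => j _; rewrite sqr_ge0.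
Qed.

Lemma l2normZ (a : R) v : l2norm (a *: v) = `|a| * l2norm v.
Proof.
rewrite /l2norm -sqrtr_sqr -sqrtrM ?sqr_ge0// mulr_sumr; congr Num.sqrt.
by apply: eq_bigr => i _; rewrite mxE exprMn.
Qed.

Lemma l2norm0 : l2norm (0 : 'rV[R]_d) = 0.
Proof. by rewrite -[0](scale0r 0) l2normZ normr0 mul0r. Qed.

Lemma l2norm_eq0 v : l2norm v = 0 -> v = 0.
Proof.
move=> v0; apply/rowP => i; apply/eqP; rewrite mxE -normr_le0 -v0.
exact: l2norm_coord.
Qed.

Lemma Cauchy_Schwarz u v : `|\sum_i u 0 i * v 0 i| <= l2norm u * l2norm v.
Proof.
(* [C] is kept opaque so that [{3}CE] below can expand one factor of the cross term only, leaving
   the others as scalars. *)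
have [C CE] : exists C, C = \sum_i u 0 i * v 0 i
  by exists (\sum_i u 0 i * v 0 i).
rewrite -CE; set A := l2norm u; set B := l2norm v.
have A0 : 0 <= A := l2norm_ge0 u; have B0 : 0 <= B := l2norm_ge0 v.
have [B_eq0|B_neq0] := eqVneq B 0.
  have -> : C = 0.
    by rewrite CE; apply: big1 => i _; rewrite (l2norm_eq0 _ B_eq0) mxE mulr0.
  by rewrite normr0 mulr_ge0.
have Bgt0 : 0 < B by rewrite lt_neqAle eq_sym B_neq0.
rewrite -ler_sqr ?nnegrE ?mulr_ge0// real_normK ?num_real//.
(* This sum of squares equals [B ^+ 2 * ((A * B) ^+ 2 - C ^+ 2)], and [B] is positive here. *)
have : 0 <= \sum_i (B ^+ 2 * u 0 i - C * v 0 i) ^+ 2.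
  by rewrite sumr_ge0// => i _; rewrite sqr_ge0.
have -> : \sum_i (B ^+ 2 * u 0 i - C * v 0 i) ^+ 2 =
    B ^+ 4 * \sum_i u 0 i ^+ 2 - 2 * B ^+ 2 * C * C + C ^+ 2 * \sum_i v 0 i ^+ 2.
  rewrite {3}CE !mulr_sumr -sumrB -big_split /=.
  by apply: eq_bigr => i _; ring.
rewrite -!sqr_l2norm -/A -/B.
have -> : B ^+ 4 * A ^+ 2 - 2 * B ^+ 2 * C * C + C ^+ 2 * B ^+ 2 =
  B ^+ 2 * ((A * B) ^+ 2 - C ^+ 2) by ring.
by rewrite pmulr_rge0 ?exprn_gt0// subr_ge0.
Qed.

Lemma l2normD u v : l2norm (u + v) <= l2norm u + l2norm v.
Proof.
apply: l2norm_le; first by rewrite addr_ge0 ?l2norm_ge0.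
have -> : \sum_i (u + v) 0 i ^+ 2 =
    \sum_i u 0 i ^+ 2 + 2 * (\sum_i u 0 i * v 0 i) + \sum_i v 0 i ^+ 2.
  rewrite mulr_sumr -!big_split /=; apply: eq_bigr => i _; rewrite mxE; ring.
rewrite sqrrD -!sqr_l2norm lerD2r lerD2l -[leRHS]mulr_natl ler_pM2l ?ltr0n//.
exact: le_trans (ler_norm _) (Cauchy_Schwarz u v).
Qed.

Lemma l2norm_conv u v (t r : R) :
  0 <= t <= 1 -> l2norm u <= r -> l2norm v <= r ->
  l2norm (t *: u + (1 - t) *: v) <= r.
Proof.
move=> /andP[t0 t1] ur vr; apply: le_trans (l2normD _ _) _.
have t1' : 0 <= 1 - t by rewrite subr_ge0.
rewrite !l2normZ !ger0_norm//.
have -> : r = t * r + (1 - t) * r by ring.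
by rewrite lerD// ler_wpM2l.
Qed.

(** Makes the [sup] in [opnorm] a genuine supremum rather than a default value. The bound is the
    Frobenius norm, by Cauchy-Schwarz on each row. *)
Lemma opnorm_has_ubound M :
  has_ubound [set l2norm (v *m M^T) | v in [set v : 'rV[R]_d | l2norm v <= 1]].
Proof.
exists (Num.sqrt (\sum_i l2norm (row i M) ^+ 2)) => _ [v /= v1 <-].
rewrite ler_wsqrtr//; apply: ler_sum => i _.
rewrite -real_normK ?num_real// ler_sqr ?nnegrE ?l2norm_ge0//.
rewrite mxE (eq_bigr (fun j => v 0 j * row i M 0 j)); last first.
  by move=> j _; rewrite !mxE.
by rewrite (le_trans (Cauchy_Schwarz _ _))// ler_piMl ?l2norm_ge0.
Qed.

Lemma opnorm_ge0 M : 0 <= opnorm M.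
Proof.
apply: (ub_le_sup (opnorm_has_ubound M)); exists 0; first by rewrite /= l2norm0.
by rewrite mul0mx l2norm0.
Qed.

Lemma l2norm_mulmx_le M v : l2norm (v *m M^T) <= opnorm M * l2norm v.
Proof.
have [v0|v0] := eqVneq (l2norm v) 0.
  by rewrite v0 mulr0 (l2norm_eq0 _ v0) mul0mx l2norm0.
have vgt0 : 0 < l2norm v by rewrite lt_neqAle eq_sym v0 l2norm_ge0.
rewrite -ler_pdivrMr// mulrC -[X in X * _]gtr0_norm ?invr_gt0//.
rewrite -l2normZ scalemxAl; apply: (ub_le_sup (opnorm_has_ubound M)).
by exists ((l2norm v)^-1 *: v); rewrite //= l2normZ gtr0_norm ?invr_gt0// mulVf.
Qed.

(** Exchanging the sums turns the left side into the inner product of [u] with [M v]. The nested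
    form is the one in which differentiating a directional derivative produces the Hessian. *)
Lemma opnorm_bilinear M u v :
  `|\sum_j v 0 j * \sum_i u 0 i * M i j| <= opnorm M * l2norm u * l2norm v.
Proof.
have -> : \sum_j v 0 j * (\sum_i u 0 i * M i j) =
    \sum_i u 0 i * (v *m M^T) 0 i.
  under eq_bigr do rewrite mulr_sumr.
  rewrite exchange_big /=; apply: eq_bigr => i _.
  by rewrite mxE mulr_sumr; apply: eq_bigr => j _; rewrite mxE mulrCA.
rewrite (le_trans (Cauchy_Schwarz _ _))//.
by rewrite [leRHS]mulrAC mulrC ler_wpM2r ?l2norm_ge0 ?l2norm_mulmx_le.
Qed.

End Euclidean.

(** * Gradient and curvature estimates on a convex set, for a gradient [G] and a Hessian [H] *)

Section SecondOrder.
Context {R : realType} {d : nat} (K : set 'rV[R]_d) (F : 'rV[R]_d -> R)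
  (G : 'I_d -> 'rV[R]_d -> R) (H : 'rV[R]_d -> 'M[R]_d).
Hypothesis K_conv : forall x y (t : R), K x -> K y -> 0 <= t <= 1 ->
  K (t *: x + (1 - t) *: y).
Hypothesis gradE : forall x v : 'rV[R]_d, K x ->
  is_derive x v F (\sum_j v 0 j * G j x).
Hypothesis hessE : forall (x v : 'rV[R]_d) j, K x ->
  is_derive x v (G j) (\sum_i v 0 i * H x i j).

Let K_seg x y (t : R) : K x -> K y -> 0 <= t <= 1 -> K (t *: (x - y) + y).
Proof.
move=> Kx Ky t01; have := K_conv x y t Kx Ky t01.
by rewrite scalerBr scalerBl scale1r addrA addrAC.
Qed.

Let is_derive_grad (u v x : 'rV[R]_d) : K x ->
  is_derive x u (fun y => \sum_j v 0 j * G j y)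
    (\sum_j v 0 j * \sum_i u 0 i * H x i j).
Proof.
move=> Kx.
have -> : (fun y => \sum_j v 0 j * G j y) = \sum_j (v 0 j \*: G j).
  by apply/funext => y; rewrite fct_sumE.
by apply: is_derive_sum => j; apply: is_deriveZ; apply: hessE.
Qed.

(** Two mean value steps: from [y] to [x] the increment of [F] is a directional derivative at some
    [xi]; from [z] to [xi] that derivative changes by a Hessian term, bounded through [opnorm]. *)
Lemma gradient_remainder_le x y z (s M : R) : K x -> K y -> K z ->
  (forall w, K w -> opnorm (H w) <= s) ->
  l2norm (x - z) <= M -> l2norm (y - z) <= M ->
  `|F x - F y - \sum_j (x - y) 0 j * G j z| <= s * l2norm (x - y) * M.
Proof.
move=> Kx Ky Kz Hs xz yz.
have [t t01] := @MVT_line _ _ F (fun w => \sum_j (x - y) 0 j * G j w) y (x - y)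
  (fun t t01 => gradE _ (x - y) (K_seg _ _ _ Kx Ky t01)).
rewrite subrK => ->.
set xi := t *: (x - y) + y.
have Kxi : K xi by exact: K_seg.
have [r r01] := @MVT_line _ _ (fun w => \sum_j (x - y) 0 j * G j w)
  (fun w => \sum_j (x - y) 0 j * \sum_i (xi - z) 0 i * H w i j) z (xi - z)
  (fun r r01 => is_derive_grad (xi - z) (x - y) _ (K_seg _ _ _ Kxi Kz r01)).
rewrite subrK => ->.
rewrite (le_trans (opnorm_bilinear _ _ _))// mulrAC.
(* Convexity of the norm bounds [xi - z] by [M], since [xi] lies between [x] and [y]. *)
have xizE : xi - z = t *: (x - z) + (1 - t) *: (y - z).
  by apply/rowP => i; rewrite !mxE; ring.
have := l2norm_conv _ _ _ _ t01 xz yz; rewrite -xizE => NM.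
rewrite ler_pM ?mulr_ge0 ?opnorm_ge0 ?l2norm_ge0//.
by rewrite ler_wpM2r ?l2norm_ge0// Hs//; exact: K_seg.
Qed.

(** Restricted to the segment from [y] to [x], [F] has the Hessian form in [x - y] as second
    derivative; [c] therefore absorbs the squared length of [x - y]. *)
Lemma strongly_concave_hessian x y (t c : R) : K x -> K y -> 0 <= t <= 1 ->
  (forall w, K w ->
     \sum_j (x - y) 0 j * \sum_i (x - y) 0 i * H w i j <= - c) ->
  t * F x + (1 - t) * F y + c / 2 * t * (1 - t) <= F (t *: x + (1 - t) *: y).
Proof.
move=> Kx Ky t01 Hc.
have := @strongly_concave_segment R (fun s => F (s *: (x - y) + y))
  (fun s => \sum_j (x - y) 0 j * G j (s *: (x - y) + y))
  (fun s => \sum_j (x - y) 0 j * \sum_i (x - y) 0 i * H (s *: (x - y) + y) i j)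
  c t.
rewrite scale1r scale0r add0r subrK.
have -> : t *: (x - y) + y = t *: x + (1 - t) *: y.
  by rewrite scalerBr scalerBl scale1r addrA addrAC.
apply => // s s01.
- apply: (proj1 (is_derive_line _ _ F y (x - y) s _)).
  by apply: gradE; exact: K_seg.
- apply: (proj1 (is_derive_line _ _ (fun w => \sum_j (x - y) 0 j * G j w)
    y (x - y) s _)).
  by apply: is_derive_grad; exact: K_seg.
- by apply: Hc; exact: K_seg.
Qed.

End SecondOrder.

(** * Derivatives at points with positive coordinates *)

Section InteriorC2.
Context {R : realType} {d : nat}.
Implicit Types (x v : 'rV[R]_d) (ell : 'rV[R]_d -> R).

Lemma near_coord_gt0 x : (forall i, 0 < x 0 i) ->
  \forall y \near x, forall i, 0 < (y : 'rV[R]_d) 0 i.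
Proof.
move=> x0.
apply: (@filter_forall _ _ (fun i (y : 'rV[R]_d) => 0 < y 0 i) (nbhs x)).
by move=> i; apply: (cvgr_gt _ (@coord_continuous _ _ _ 0 i x)).
Qed.

Lemma interior_orthant x : (forall i, 0 < x 0 i) -> (orthant R d)° x.
Proof.
move=> /near_coord_gt0; rewrite /interior; apply: filterS => y y0 i.
exact: ltW.
Qed.

Let within_interior_continuous (F : 'rV[R]_d -> R) x :
  {within (orthant R d)°, continuous F} -> (forall i, 0 < x 0 i) ->
  {for x, continuous F}.
Proof.
move=> Fc x0; have ix := interior_orthant x x0.
move/subspace_continuousP: Fc => /(_ _ ix).
by rewrite within_interior //; have /interior_id -> := open_interior (orthant R d).
Qed.

(** Near such a point only the two-sided branch of [has_partial] and [partial] occurs, so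
    [is_derive_partials] applies. *)
Lemma is_derive_partial_sum ell x v : C2_on (orthant R d)° ell ->
  (forall i, 0 < x 0 i) ->
  is_derive x v ell (\sum_j v 0 j * partial ell j x).
Proof.
move=> [hp _ _ pc _] x0; apply: is_derive_partials; last first.
  by move=> i; apply: within_interior_continuous.
apply: filterS (near_coord_gt0 x x0) => y y0 i.
have oy := interior_orthant y y0.
have /nbhs_singleton /(_ (interior_subset oy)) := hp y i oy.
by rewrite /has_partial /partial y0 => /derivableP.
Qed.

Lemma is_derive_hessian_sum ell x v j : C2_on (orthant R d)° ell ->
  (forall i, 0 < x 0 i) ->
  is_derive x v (partial ell j) (\sum_i v 0 i * hessian ell x i j).
Proof.
move=> [_ hp _ _ hc] x0.
apply: (is_derive_partials _ _ _ (fun i y => hessian ell y i j)); last first.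
  by move=> i; apply: within_interior_continuous.
apply: filterS (near_coord_gt0 x x0) => y y0 i.
have := hp y i j (interior_orthant y y0).
by rewrite mxE /has_partial [partial (partial _ _) i y]/partial y0 => /derivableP.
Qed.

End InteriorC2.

(** * Restriction to a set of coordinates and extension by zero *)

Section Subvectors.
Context {R : realType} {d : nat} (S : {set 'I_d}).
Implicit Types (x y : 'rV[R]_d) (u v : 'rV[R]_#|S|).

(** Written as a product with the 0-1 matrix of the coordinate inclusion, so that linearity comes
    from the rules for [mulmx]. *)
Definition extend u : 'rV[R]_d :=
  u *m \matrix_(k < #|S|, i < d) (enum_val k == i)%:R.

Lemma ex_enum_val i : i \in S -> exists k : 'I_#|S|, i = enum_val k.
Proof. by move=> iS; exists (enum_rank_in iS i); rewrite enum_rankK_in. Qed.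

Lemma extend_enum_val u k : extend u 0 (enum_val k) = u 0 k.
Proof.
rewrite mxE (bigD1 k)//= mxE eqxx mulr1 big1 ?addr0// => l lk.
by rewrite mxE (inj_eq enum_val_inj) (negPf lk) mulr0.
Qed.

Lemma extend_notin u i : i \notin S -> extend u 0 i = 0.
Proof.
move=> iS; rewrite mxE big1// => k _; rewrite mxE; case: eqP; rewrite ?mulr0//.
by move=> ki; rewrite -ki enum_valP in iS.
Qed.

Lemma subvec_extend u : subvec S (extend u) = u.
Proof. by apply/rowP => k; rewrite mxE extend_enum_val. Qed.

Lemma subvecB x y : subvec S (x - y) = subvec S x - subvec S y.
Proof. by apply/rowP => k; rewrite !mxE. Qed.

Lemma subvec_conv (t s : R) x y :
  subvec S (t *: x + s *: y) = t *: subvec S x + s *: subvec S y.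
Proof. by apply/rowP => k; rewrite !mxE. Qed.

Lemma sqr_l2norm_subvec x : l2norm (subvec S x) ^+ 2 = \sum_(i in S) x 0 i ^+ 2.
Proof.
rewrite sqr_l2norm [RHS]big_enum_val.
by apply: eq_bigr => k _; rewrite mxE.
Qed.

Lemma l2norm_subvec x : (forall i, i \notin S -> x 0 i = 0) ->
  l2norm (subvec S x) = l2norm x.
Proof.
move=> x0; apply/eqP; rewrite -(@eqrXn2 _ 2) ?l2norm_ge0//.
rewrite sqr_l2norm_subvec sqr_l2norm [X in _ == X](bigID (mem S))/= [X in _ + X]big1.
  by rewrite addr0.
by move=> i /x0 ->; rewrite expr0n.
Qed.

(** A vector supported on [S] sees only the [S] block of [M]: [supp] reindexes both sums by
    [enum_val]. *)
Lemma quadratic_form_le (M : 'M[R]_d) (c : R) x :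
  loewner_ge (- submat S M) c%:M -> (forall i, i \notin S -> x 0 i = 0) ->
  \sum_j x 0 j * \sum_i x 0 i * M i j <= - (c * l2norm x ^+ 2).
Proof.
move=> /(_ (subvec S x)) + x0.
have supp (f : 'I_d -> R) :
    \sum_j x 0 j * f j = \sum_k subvec S x 0 k * f (enum_val k).
  rewrite (bigID (mem S))/= [X in _ + X]big1 ?addr0; last first.
    by move=> i /x0 ->; rewrite mul0r.
  rewrite big_enum_val.
  by apply: eq_bigr => k _; rewrite mxE.
rewrite -(l2norm_subvec _ x0) sqr_l2norm supp.
under [X in _ -> X <= _]eq_bigr do rewrite supp.
move=> M0; rewrite -subr_ge0; move: M0; set a := subvec S x.
suff -> : (a *m (- submat S M - c%:M) *m a^T) 0 0 =
  - (c * \sum_k a 0 k ^+ 2) -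
    \sum_k a 0 k * (\sum_l a 0 l * M (enum_val l) (enum_val k)) by [].
rewrite mxE mulr_sumr -!sumrN -big_split /=; apply: eq_bigr => k _.
rewrite mulmxBr mul_mx_scalar mulmxN !mxE.
under [in LHS]eq_bigr do rewrite !mxE.
under [in RHS]eq_bigr do rewrite mxE.
ring.
Qed.

End Subvectors.

(** The path tends to [x] and stays in [A] for small positive [e], which is all that continuity
    relative to [A] requires. *)
Lemma within_continuous_path (R : realType) (d : nat) (A : set 'rV[R]_d)
    (F : 'rV[R]_d -> R) (c x : 'rV[R]_d) :
  {within A, continuous F} -> A x ->
  (forall e : R, 0 < e < 1 -> A ((1 - e) *: x + e *: c)) ->
  F ((1 - e) *: x + e *: c) @[e --> (0 : R)^'+] --> F x.
Proof.
move=> /subspace_continuousP /(_ x) Fc Ax Ae.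
apply: cvg_comp (Fc Ax) => B /= AB.
have pc : ((1 - e) *: x + e *: c) @[e --> (0 : R)^'+] --> x.
  apply: cvg_at_right_filter.
  rewrite [X in _ --> X](_ : x = (1 - 0) *: x + 0 *: c); last first.
    by rewrite subr0 scale1r scale0r addr0.
  apply: cvgD; apply: cvgZr_tmp; last exact: cvg_id.
  by apply: cvgB; [exact: cvg_cst|exact: cvg_id].
have {}AB := pc _ AB; near=> e.
have : A ((1 - e) *: x + e *: c).
  by apply: Ae; apply/andP; split; near: e;
    [exact: nbhs_right_gt|exact: nbhs_right_lt].
by near: e.
Unshelve. all: by end_near. Qed.

(** * Geometry of the good set *)

Section GoodSet.
Context {R : realType} {d : nat} {that : 'rV[R]_d} {n delta0 delta1 : R}
  (n_gt0 : 0 < n) (delta0_gt0 : 0 < delta0) (delta1_gt0 : 0 < delta1)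
  (that_ge0 : orthant R d that).
Implicit Types x y : 'rV[R]_d.

Let r : R := delta0 * Num.sqrt (#|S0 that|%:R / n).
(** Euclidean radius of the [S1] block, obtained from its sup-norm radius [delta1 / n]. *)
Let q : R := Num.sqrt #|S1 that|%:R * (delta1 / n).
Let A := good_set that n delta0 delta1.

Let dn_gt0 : 0 < delta1 / n. Proof. exact: divr_gt0. Qed.

Let r_ge0 : 0 <= r. Proof. by rewrite mulr_ge0 ?sqrtr_ge0 ?ltW. Qed.

Let q_ge0 : 0 <= q. Proof. by rewrite mulr_ge0 ?sqrtr_ge0 ?ltW. Qed.

Lemma mem_S1 i : (i \in S1 that) = (i \notin S0 that).
Proof. by rewrite !inE lt_neqAle that_ge0 andbT negbK eq_sym. Qed.

Lemma that_S1 i : i \in S1 that -> that 0 i = 0.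
Proof. by rewrite inE => /eqP. Qed.

(** Since [that] vanishes on [S1] and coordinates are nonnegative, the sup-norm condition needs
    neither a subtraction nor an absolute value. *)
Lemma good_setP x : A x <->
  [/\ orthant R d x, l2norm (subvec (S0 that) (x - that)) <= r &
      forall j, j \in S1 that -> x 0 j <= delta1 / n].
Proof.
rewrite subvecB; split=> -[ox bx sx]; split=> //.
  move=> j jS; have := le_trans (ler_norm_coord _ _ _ (enum_rank_in jS j)) sx.
  rewrite !mxE enum_rankK_in// that_S1// subr0.
  exact/le_trans/ler_norm.
rewrite [leLHS]/Num.Def.normr /= mx_normrE.
(* The first goal concerns the default value 0 of the maximum. *)
apply: bigmax_le => [|[i j] _]; first exact: ltW.
rewrite /= ord1 !mxE that_S1 ?enum_valP// subr0 ger0_norm ?ox//.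
exact/sx/enum_valP.
Qed.

Lemma good_set_conv x y (t : R) : A x -> A y -> 0 <= t <= 1 ->
  A (t *: x + (1 - t) *: y).
Proof.
move=> /good_setP[ox bx sx] /good_setP[oy by_ sy] t01.
have /andP[t0 t1] := t01; have t1' : 0 <= 1 - t by rewrite subr_ge0.
apply/good_setP; split.
- by move=> i; rewrite !mxE addr_ge0// mulr_ge0 ?ox ?oy.
- have -> : t *: x + (1 - t) *: y - that =
      t *: (x - that) + (1 - t) *: (y - that).
    by apply/rowP => i; rewrite !mxE; ring.
  by rewrite subvec_conv l2norm_conv.
- move=> j jS; rewrite !mxE.
  have -> : delta1 / n = t * (delta1 / n) + (1 - t) * (delta1 / n) by ring.
  by rewrite lerD// ler_wpM2l ?sx ?sy.
Qed.

Lemma good_set_center : A that.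
Proof.
apply/good_setP; split=> // [|j /that_S1 ->]; last exact: ltW.
by rewrite subvecB subrr l2norm0.
Qed.

(** Coordinates in [S0] move by at most [r < C0 <= that 0 i], so the extended point stays in the
    orthant. *)
Lemma good_set_extend (u : 'rV[R]_#|S0 that|) C0 : r < C0 ->
  (forall i, i \in S0 that -> C0 <= that 0 i) ->
  l2ball (subvec (S0 that) that) r u -> A (extend (S0 that) u).
Proof.
move=> rC C0_le ur; apply/good_setP; split.
- move=> i; have [iS|iS] := boolP (i \in S0 that); last by rewrite extend_notin.
  have := C0_le i iS; have [k ->] := ex_enum_val _ _ iS.
  have := le_trans (l2norm_coord _ k) ur.
  by rewrite extend_enum_val !mxE ler_norml => /andP[+ _]; lra.
- by rewrite subvecB subvec_extend.
- by move=> j; rewrite mem_S1 => jS; rewrite extend_notin// ltW.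
Qed.

Lemma sum_split (f : 'I_d -> R) :
  \sum_i f i = \sum_(i in S0 that) f i + \sum_(i in S1 that) f i.
Proof.
rewrite (bigID (mem (S0 that)))/=; congr (_ + _).
by apply: eq_bigl => i; rewrite mem_S1.
Qed.

Let sum_S1_le x : A x -> \sum_(i in S1 that) x 0 i ^+ 2 <= q ^+ 2.
Proof.
move=> /good_setP[ox _ sx].
rewrite exprMn sqr_sqrtr// mulr_natl -sumr_const; apply: ler_sum => i iS.
by rewrite ler_sqr ?nnegrE ?ox ?sx ?(ltW dn_gt0).
Qed.

Lemma good_set_dist x : A x -> l2norm (x - that) <= r + q.
Proof.
move=> Ax; have /good_setP[ox bx sx] := Ax.
apply: l2norm_le; first by rewrite addr_ge0.
rewrite sum_split -sqr_l2norm_subvec.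
have -> : \sum_(i in S1 that) (x - that) 0 i ^+ 2 =
    \sum_(i in S1 that) x 0 i ^+ 2.
  by apply: eq_bigr => i iS; rewrite !mxE that_S1// subr0.
have b2 : l2norm (subvec (S0 that) (x - that)) ^+ 2 <= r ^+ 2.
  by rewrite ler_sqr ?nnegrE ?l2norm_ge0.
(* The cross term [2 r q] is the slack between [r ^+ 2 + q ^+ 2] and [(r + q) ^+ 2]. *)
have := sum_S1_le _ Ax; have : 0 <= r * q by rewrite mulr_ge0.
by move: b2; lra.
Qed.

Lemma good_set_dist_extend x : A x ->
  l2norm (x - extend (S0 that) (subvec (S0 that) x)) <= q.
Proof.
move=> Ax; apply: l2norm_le => //; rewrite sum_split.
rewrite [X in X + _]big1 ?add0r; last first.
  move=> i /ex_enum_val[k ->].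
  by rewrite mxE [X in _ + X]mxE extend_enum_val mxE subrr expr0n.
rewrite (le_trans _ (sum_S1_le _ Ax))//; apply: ler_sum => i.
by rewrite mem_S1 => iS; rewrite mxE [X in _ + X]mxE extend_notin ?subr0.
Qed.

(** The product [q r] gives the term in [n^(-3/2)] and [q ^+ 2] the term in [n^(-2)]. *)
Lemma good_set_radii (s : R) : s * q * (r + q) =
  s * (delta0 * delta1 * Num.sqrt (#|S0 that| * #|S1 that|)%:R / n `^ (3 / 2)
       + delta1 ^+ 2 * #|S1 that|%:R / n ^+ 2).
Proof.
have n32 : n `^ (3 / 2) = n * Num.sqrt n.
  rewrite (_ : 3 / 2 = 1 + 2^-1); last by field.
  by rewrite powRD ?gt_eqF ?implybT// powRr1 ?ltW// powR12_sqrt ?ltW.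
rewrite -mulrA; congr (s * _).
rewrite mulrDr -expr2 exprMn sqr_sqrtr// n32 natrM sqrtrM//.
rewrite /r /q sqrtrM// sqrtrV ?ltW//.
have : Num.sqrt n != 0 by rewrite gt_eqF ?sqrtr_gt0.
by move=> ?; field; rewrite gt_eqF.
Qed.

End GoodSet.

(* Boundary points of the orthant are reached as limits along the contraction
   [x |-> (1 - e) x + e c] towards a point [c] with positive coordinates. *)
Section ClosureC2.
Context {R : realType} {d : nat} {ell : 'rV[R]_d -> R} {A : set 'rV[R]_d}
  {c : 'rV[R]_d}
  (A_conv : forall x y (t : R), A x -> A y -> 0 <= t <= 1 ->
     A (t *: x + (1 - t) *: y))
  (A_orthant : A `<=` orthant R d) (Ac : A c) (c_gt0 : forall i, 0 < c 0 i)
  (ell_C2 : C2_on (orthant R d)° ell) (ell_cont : {within A, continuous ell})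
  (partial_cont : forall j, {within A, continuous (partial ell j)}).
Implicit Types x y z w : 'rV[R]_d.

(** Points of [K] are interior to the orthant but possibly on the boundary of [A]. Their derivatives
    come from [ell_C2], and bounds on the Hessian from membership in [A]. *)
Let K : set 'rV[R]_d := [set x | A x /\ forall i, 0 < x 0 i].

Let p (e : R) x := (1 - e) *: x + e *: c.

Let p_in x (e : R) : A x -> 0 < e < 1 -> K (p e x).
Proof.
move=> Ax /andP[e0 e1]; split=> [|i].
  by have := A_conv c x e Ac Ax; rewrite !ltW// addrC; exact.
by rewrite !mxE ltr_wpDl ?mulr_gt0// mulr_ge0 ?A_orthant// subr_ge0 ltW.
Qed.

Let p_cvg (F : 'rV[R]_d -> R) x : {within A, continuous F} -> A x ->
  F (p e x) @[e --> (0 : R)^'+] --> F x.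
Proof.
move=> Fc Ax; apply: (within_continuous_path _ _ _ _ _ _ Fc Ax) => e.
by move=> /(p_in x e Ax)[].
Qed.

Let near01 : \forall e \near (0 : R)^'+, 0 < e < 1.
Proof.
near=> e; apply/andP; split; near: e;
  [exact: nbhs_right_gt|exact: nbhs_right_lt].
Unshelve. all: by end_near. Qed.

Let pB (e : R) x y : p e x - p e y = (1 - e) *: (x - y).
Proof. by apply/rowP => i; rewrite !mxE; ring. Qed.

Let cvg_1B : (1 - e) @[e --> (0 : R)^'+] --> (1 : R).
Proof.
apply: cvg_at_right_filter; rewrite -[X in _ --> X]subr0.
by apply: cvgB; [exact: cvg_cst|exact: cvg_id].
Qed.

Let K_conv x y (t : R) : K x -> K y -> 0 <= t <= 1 -> K (t *: x + (1 - t) *: y).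
Proof.
move=> [Ax x0] [Ay y0] t01; split; first exact: A_conv.
move=> i; have /andP[t0 t1] := t01; rewrite !mxE.
have [->|t_neq0] := eqVneq t 0; first by rewrite mul0r add0r subr0 mul1r.
rewrite ltr_pwDl//; first by rewrite mulr_gt0// lt_neqAle eq_sym t_neq0.
by rewrite mulr_ge0 ?subr_ge0// ltW.
Qed.

Let K_grad x (v : 'rV[R]_d) : K x ->
  is_derive x v ell (\sum_j v 0 j * partial ell j x).
Proof. by move=> [_ x0]; exact: is_derive_partial_sum. Qed.

Let K_hess x (v : 'rV[R]_d) j : K x ->
  is_derive x v (partial ell j) (\sum_i v 0 i * hessian ell x i j).
Proof. by move=> [_ x0]; exact: is_derive_hessian_sum. Qed.

(** The contraction multiplies differences by [1 - e], so the norm bounds survive. In the limit only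
    [ell] and its first partial derivatives must converge; the Hessian enters through the uniform
    bound [s]. *)
Lemma gradient_remainder_le_closure x y z (s M : R) : A x -> A y -> A z ->
  (forall w, A w -> opnorm (hessian ell w) <= s) ->
  l2norm (x - z) <= M -> l2norm (y - z) <= M ->
  `|ell x - ell y - \sum_j (x - y) 0 j * partial ell j z|
    <= s * l2norm (x - y) * M.
Proof.
move=> Ax Ay Az Hs xz yz.
have contract (u : 'rV[R]_d) (e N : R) : 0 < e < 1 -> l2norm u <= N ->
    l2norm ((1 - e) *: u) <= N.
  move=> /andP[e0 e1]; apply: le_trans.
  rewrite l2normZ ger0_norm ?subr_ge0 ?(ltW e1)// ler_piMl ?l2norm_ge0//.
  by rewrite gerBl ltW.
have s0 : 0 <= s by exact: le_trans (opnorm_ge0 _) (Hs x Ax).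
have M0 : 0 <= M by exact: le_trans (l2norm_ge0 _) xz.
apply: (@ler_cvg_to _ ((0 : R)^'+) _ _ (fun e : R => `|ell (p e x) - ell (p e y) -
    \sum_j ((1 - e) * (x - y) 0 j) * partial ell j (p e z)|)
  (fun=> s * l2norm (x - y) * M)).
- apply: cvg_norm; apply: cvgB; first by apply: cvgB; exact: p_cvg.
  apply: cvg_big => [|j _]; first exact: add_continuous.
  apply: cvgM; last exact: p_cvg.
  rewrite -[X in _ --> X]mul1r; apply: cvgM cvg_1B _; exact: cvg_cst.
- exact: cvg_cst.
- apply: filterS near01 => e e01.
  have := @gradient_remainder_le R d K ell (partial ell) (hessian ell)
    K_conv K_grad K_hess (p e x) (p e y) (p e z) s M.
  rewrite !pB => /(_ (p_in _ _ Ax e01) (p_in _ _ Ay e01) (p_in _ _ Az e01)).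
  move=> /(_ (fun w Kw => Hs w (proj1 Kw)) (contract _ _ _ e01 xz)
    (contract _ _ _ e01 yz)).
  under eq_bigr do rewrite mxE.
  move=> /le_trans; apply.
  by rewrite ler_wpM2r// ler_wpM2l// contract.
Qed.

Lemma strongly_concave_closure x y (t k : R) : A x -> A y -> 0 <= t <= 1 ->
  (forall w, A w ->
     \sum_j (x - y) 0 j * \sum_i (x - y) 0 i * hessian ell w i j <= - k) ->
  t * ell x + (1 - t) * ell y + k / 2 * t * (1 - t)
    <= ell (t *: x + (1 - t) *: y).
Proof.
move=> Ax Ay t01 Hk.
(* At the contracted points the Hessian form in the difference scales by [(1 - e) ^+ 2], hence so
   does the modulus. *)
have k_cvg : k * (1 - e) ^+ 2 @[e --> (0 : R)^'+] --> k.
  rewrite -[X in _ --> X]mulr1 -[X in _ --> k * X](expr1n _ 2).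
  apply: cvgM; first exact: cvg_cst.
  by rewrite expr2; under eq_fun do rewrite expr2; exact: cvgM.
apply: (@ler_cvg_to _ ((0 : R)^'+) _ _ (fun e : R => t * ell (p e x) +
    (1 - t) * ell (p e y) + k * (1 - e) ^+ 2 / 2 * t * (1 - t))
  (fun e : R => ell (p e (t *: x + (1 - t) *: y)))).
- apply: cvgD; first apply: cvgD; try by apply: cvgM (cvg_cst _) _; exact: p_cvg.
  by do 3![apply: cvgM; last exact: cvg_cst].
- by apply: p_cvg => //; exact: A_conv.
- apply: filterS near01 => e e01.
  have -> : p e (t *: x + (1 - t) *: y) = t *: p e x + (1 - t) *: p e y.
    by apply/rowP => i; rewrite !mxE; ring.
  apply: (@strongly_concave_hessian R d K ell (partial ell) (hessian ell)
    K_conv K_grad K_hess) => //; try exact: p_in.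
  move=> w [Aw _]; rewrite pB.
  have -> : \sum_j ((1 - e) *: (x - y)) 0 j *
      (\sum_i ((1 - e) *: (x - y)) 0 i * hessian ell w i j) =
      (1 - e) ^+ 2 *
      \sum_j (x - y) 0 j * (\sum_i (x - y) 0 i * hessian ell w i j).
    rewrite mulr_sumr; apply: eq_bigr => j _.
    under eq_bigr do rewrite mxE -mulrA.
    by rewrite -mulr_sumr mxE; ring.
  by rewrite mulrC -mulNr ler_wpM2r ?sqr_ge0 ?Hk.
Qed.

End ClosureC2.

(** * Assembly of the decomposition on the good set *)

Theorem theorem3p3 (R : realType) (d : nat)
    (ell : 'rV[R]_d -> R) (that : 'rV[R]_d)
    (prior : 'rV[R]_d -> R) (prior1 : 'I_d -> R -> R)
    (n delta0 delta1 C0 CS0 CS1 s2 : R)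
    (n_gt0 : 0 < n) (delta0_gt0 : 0 < delta0) (delta1_gt0 : 0 < delta1)
    (that_max : unique_maximizer (orthant R d) ell that)
    (prior_prod : forall x, orthant R d x ->
      prior x = \prod_(j < d) prior1 j (x 0 j))
    (prior_logconcave : forall j, log_concave_nneg (prior1 j))
    (ell_C2_interior : C2_on (orthant R d)° ell)
    (d1_ge1 : (1 <= #|S1 that|)%N)
    (C0_gt0 : 0 < C0)
    (that_ge : (C0%:E <=
      ereal_inf [set (`|that 0%R i|)%:E | i in [set i | i \in S0 that]])%E)
    (radius_bounds : 0 < delta0 * Num.sqrt (#|S0 that|%:R / n) < C0)
    (CS0_gt0 : 0 < CS0)
    (hess_S0 : forall x, good_set that n delta0 delta1 x ->
      loewner_ge (- submat (S0 that) (hessian ell x)) (CS0%:M))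
    (CS1_gt0 : 0 < CS1)
    (grad_S1 : forall j, j \in S1 that -> partial ell j that <= - CS1)
    (ell_C2 : C2_on (good_set that n delta0 delta1) ell)
    (hess_bound : (ereal_sup [set (opnorm (hessian ell x))%:E
      | x in good_set that n delta0 delta1] <= s2%:E)%E) :
  exists (f : 'rV[R]_#|S0 that| -> R) (g : 'I_d -> R -> R)
         (B : 'rV[R]_d -> R),
    [/\ forall x, good_set that n delta0 delta1 x ->
          ell x = B x + f (subvec (S0 that) x)
                  + \sum_(j in S1 that) g j (x 0 j),
        strongly_concave_on
          (l2ball (subvec (S0 that) that)
                  (delta0 * Num.sqrt (#|S0 that|%:R / n))) CS0 f,
        forall j, j \in S1 that ->
          (forall u, 0 <= u <= delta1 / n -> g j u = partial ell j that * u)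
          /\ partial ell j that <= - CS1 &
        (osc_on (good_set that n delta0 delta1) B <=
          (2 * s2 * (delta0 * delta1 * Num.sqrt (#|S0 that| * #|S1 that|)%:R
                       / n `^ (3 / 2)
                     + delta1 ^+ 2 * #|S1 that|%:R / n ^+ 2))%:E)%E].
Proof.
have [that_ge0 _ _] := that_max.
have C0_le i : i \in S0 that -> C0 <= that 0 i.
  move=> iS; rewrite -[leRHS]ger0_norm// -lee_fin.
  by apply: le_trans that_ge (ereal_inf_lbound _); exists i.
set A := good_set that n delta0 delta1.
set r := delta0 * Num.sqrt (#|S0 that|%:R / n).
have /andP[_ rC] := radius_bounds.
have dn_gt0 : 0 < delta1 / n by exact: divr_gt0.
have opnorm_le w : A w -> opnorm (hessian ell w) <= s2.
  move=> Aw; rewrite -lee_fin; apply: le_trans hess_bound.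
  by apply: ereal_sup_ubound; exists w.
(* Centre of the contraction: the zero coordinates of [that] are raised to [delta1 / n], the largest
   value that the good set allows. *)
pose c : 'rV[R]_d := \row_i (if i \in S1 that then delta1 / n else that 0 i).
have c_gt0 i : 0 < c 0 i.
  rewrite mxE mem_S1//; case: ifPn => // /negbNE iS.
  exact: lt_le_trans (C0_le i iS).
have Ac : A c.
  apply/good_setP => //; split=> [i||j jS]; [exact: ltW| |by rewrite mxE jS].
  have -> : subvec (S0 that) (c - that) = 0.
    by apply/rowP => k; rewrite !mxE mem_S1// enum_valP /= subrr.
  by rewrite l2norm0 mulr_ge0 ?sqrtr_ge0// ltW.
have A_conv (x y : 'rV[R]_d) (t : R) : A x -> A y -> 0 <= t <= 1 ->
    A (t *: x + (1 - t) *: y) by exact: good_set_conv.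
have A_orthant : A `<=` orthant R d by move=> x [].
have [_ _ ell_cont partial_cont _] := ell_C2.
pose f u := ell (extend (S0 that) u).
pose g (j : 'I_d) u := partial ell j that * u.
pose B x := ell x - f (subvec (S0 that) x) - \sum_(j in S1 that) g j (x 0 j).
exists f, g, B; split.
- by move=> x _; rewrite /B; ring.
- move=> u v t ur vr t01.
  have extendB : extend (S0 that) u - extend (S0 that) v =
    extend (S0 that) (u - v) by rewrite /extend mulmxBl.
  (* The strong concavity of [ell] is used between two points [(u, 0)] and [(v, 0)], with the
     squared distance absorbed in the modulus. *)
  have := strongly_concave_closure A_conv A_orthant Ac c_gt0 ell_C2_interior
    ell_cont (extend (S0 that) u) (extend (S0 that) v) t
    (CS0 * l2norm (u - v) ^+ 2).
  have Au := good_set_extend n_gt0 delta1_gt0 that_ge0 _ _ rC C0_le ur.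
  have Av := good_set_extend n_gt0 delta1_gt0 that_ge0 _ _ rC C0_le vr.
  rewrite extendB => /(_ Au Av t01).
  have -> : t *: extend (S0 that) u + (1 - t) *: extend (S0 that) v =
    extend (S0 that) (t *: u + (1 - t) *: v).
    by rewrite /extend mulmxDl -!scalemxAl.
  have -> : CS0 * l2norm (u - v) ^+ 2 / 2 * t * (1 - t) =
    CS0 / 2 * t * (1 - t) * l2norm (u - v) ^+ 2 by ring.
  apply => w Aw; rewrite -[in leRHS](subvec_extend (S0 that) (u - v)).
  rewrite l2norm_subvec; last by move=> i; exact: extend_notin.
  apply: quadratic_form_le; first exact: hess_S0.
  by move=> i; exact: extend_notin.
- by move=> j jS; split=> //; exact: grad_S1.
set q := Num.sqrt #|S1 that|%:R * (delta1 / n).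
have s2_ge0 : 0 <= s2 := le_trans (opnorm_ge0 _) (opnorm_le _ Ac).
have rq_ge0 : 0 <= r + q.
  exact: le_trans (l2norm_ge0 _)
    (good_set_dist n_gt0 delta0_gt0 delta1_gt0 that_ge0 _ Ac).
(* The point [y] is [x] with its [S1] coordinates set to 0. As [x - y] lives on [S1], the sum of the
   [g j] is the gradient term at [that], and [B x] is the remainder with [|x - y| <= q] and both
   points within [r + q] of [that]. *)
have B_le x : A x -> `|B x| <= s2 * q * (r + q).
  move=> Ax; set y := extend (S0 that) (subvec (S0 that) x).
  have Ay : A y.
    have [_ bx _] := Ax.
    exact: good_set_extend n_gt0 delta1_gt0 that_ge0 _ _ rC C0_le bx.
  have -> : B x = ell x - ell y - \sum_j (x - y) 0 j * partial ell j that.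
    rewrite /B; congr (_ - _); rewrite (sum_split that_ge0) [X in _ = X + _]big1.
      rewrite add0r; apply: eq_bigr => j; rewrite mem_S1// => jS.
      by rewrite mxE [X in _ + X]mxE extend_notin ?subr0 1?mulrC.
    move=> j /ex_enum_val[k ->].
    by rewrite mxE [X in _ + X]mxE extend_enum_val mxE subrr mul0r.
  apply: le_trans (gradient_remainder_le_closure A_conv A_orthant Ac c_gt0
    ell_C2_interior ell_cont partial_cont x y that s2 (r + q) Ax Ay _ opnorm_le
    _ _) _; try exact: good_set_dist.
    exact: good_set_center.
  by rewrite ler_wpM2r// ler_wpM2l// (good_set_dist_extend (delta0 := delta0)).
(* The factor 2 is the width of the interval from [- b] to [b], where [b = s2 * q * (r + q)] bounds
   [|B|]. *)
have -> : 2 * s2 * (delta0 * delta1 * Num.sqrt (#|S0 that| * #|S1 that|)%:R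
    / n `^ (3 / 2) + delta1 ^+ 2 * #|S1 that|%:R / n ^+ 2) =
    s2 * q * (r + q) - - (s2 * q * (r + q)).
  by rewrite good_set_radii//; ring.
rewrite EFinB /osc_on; apply: leeB.
- apply: ge_ereal_sup => _ [x Ax <-].
  by rewrite lee_fin (le_trans (ler_norm _))// B_le.
- apply: le_ereal_inf_tmp => _ [x Ax <-].
  by rewrite lee_fin lerNl (le_trans _ (B_le x Ax))// -normrN ler_norm.
Qed.
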